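(* Let $X$ be a proper metric space. The boundary $\Omega X=\varepsilon X\setminus X$ of the Freudenthal compactification $\varepsilon X$ of $X$ is totally disconnected. If $\bar X$ is another coarse compactification of $X$ whose boundary $\bar X\setminus X$ is totally disconnected, then it factors through $\varepsilon X$: there is a surjective map $\varepsilon X\to\bar X$ which is continuous on the boundary and the identity on $X$.
   Context: A metric space is proper if every bounded subset has compact closure. A compactification of $X$ is a compact Hausdorff space $\bar X$ with an open embedding $X\to\bar X$ with dense image; $X$ is identified with its image, and $\bar X\setminus X$ is the boundary. An entourage of $(X,d)$ is a subset $E\subseteq X\times X$ with $\sup_{(x,y)\in E}d(x,y)<\infty$; for $T\subseteq X$ put $E[T]=\{x:\exists y\in T,(x,y)\in E\}$. The compactification $\bar X$ is coarse if for every two nets $(x_i)_i,(y_i)_i$ in $X$ such that $\{(x_i,y_i)\}_i$ is an entourage, both nets have the same limit (cluster) points on the boundary. Closeness: for $A,B\subseteq X$, $A$ and $B$ are close if there is an unbounded sequence $(a_i,b_i)_i$ in $A\times B$ and $R\ge0$ with $d(a_i,b_i)\le R$ for all $i$. Write $A\,\bar r\,B$ if there exist $A'\supseteq A$, $B'\supseteq B$ with $A'\cup B'=X$ and $A',B'$ not close; let $A\,r\,B$ be the negation of $A\,\bar r\,B$ (this is the relation ''having a common end''). Freudenthal compactification (coarse version): a Delone subset of $X$ is a subset $S$ such that for some $R>0$, $d(s,t)\ge R$ for all distinct $s,t\in S$, and $E[S]=X$ for some entourage $E$. Let $S\subseteq X$ be Delone, $\hat S$ the set of nonprincipal ultrafilters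 on $S$, and $\sigma\lambda_r\tau$ iff $A\,r\,B$ for all $A\in\sigma,B\in\tau$ (an equivalence relation). Put $\Omega X=\hat S/\lambda_r$, and for $A\subseteq X$ let $\mathrm{cl}(A)=\{[\sigma]\in\Omega X:A\,r\,B\text{ for all }B\in\sigma\}$. Then $\varepsilon X=X\sqcup\Omega X$ with closed sets generated by the sets $\bar A\cup\mathrm{cl}(A)$, $A\subseteq X$, where $\bar A$ is the closure in $X$; it is (up to homeomorphism) independent of $S$ and is a coarse compactification of $X$. *)

(* Defs.v *)
From HB Require Import structures.
From mathcomp Require Import all_boot all_order all_algebra.
From mathcomp Require Import all_classical all_reals all_analysis.

Set Implicit Arguments.
Unset Strict Implicit.
Unset Printing Implicit Defensive.

Import Order.TTheory GRing.Theory Num.Theory.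

Local Open Scope classical_set_scope.
Local Open Scope ring_scope.

Section CoarseGeometry.
Context {R : realType} {X : metricType R}.

(* [entourage] and [bounded_set] of the library are a uniform and a
   normed-module notion; the coarse/metric ones are defined here. *)
Definition metric_bounded (A : set X) : Prop :=
  exists M : R, forall x y, A x -> A y -> mdist x y <= M.

Definition coarse_entourage (E : set (X * X)) : Prop :=
  exists M : R, forall x y, E (x, y) -> mdist x y <= M.

Definition entourage_image (E : set (X * X)) (T : set X) : set X :=
  [set x | exists2 y, T y & E (x, y)].

(* A sequence of pairs is unbounded in the product X * X iff one of its two
   components has unbounded range. *)
Definition are_close (A B : set X) : Prop :=
  exists a b : nat -> X,
    [/\ forall i, A (a i), forall i, B (b i),
        ~ (metric_bounded (range a) /\ metric_bounded (range b)) &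
        exists2 r : R, 0 <= r & forall i, mdist (a i) (b i) <= r].

Definition end_separated (A B : set X) : Prop :=
  exists A' B' : set X,
    [/\ A `<=` A', B `<=` B', A' `|` B' = setT & ~ are_close A' B'].

Definition common_end (A B : set X) : Prop := ~ end_separated A B.

Definition delone (S : set X) : Prop :=
  (exists2 r : R, 0 < r &
     forall s t, S s -> S t -> s <> t -> r <= mdist s t) /\
  (exists2 E, coarse_entourage E & entourage_image E S = setT).

End CoarseGeometry.

Definition proper_metric (R : realType) (X : metricType R) : Prop :=
  forall A : set X, metric_bounded A -> compact (closure A).

Section Compactifications.

Definition directed (I : Type) (le : I -> I -> Prop) : Prop :=
  [/\ inhabited I, forall i, le i i,
      forall i j k, le i j -> le j k -> le i k &
      forall i j, exists2 k, le i k & le j k].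

(* The filter generated by the tails of a net; its library [cluster] is the set
   of cluster points of the net. *)
Definition net_tails (I T : Type) (le : I -> I -> Prop) (x : I -> T) :
    set_system T :=
  filter_from [set: I] (fun i => x @` [set j | le i j]).

Definition open_embedding (X Y : topologicalType) (iota : X -> Y) : Prop :=
  [/\ injective iota, continuous iota &
      forall U : set X, open U -> open (iota @` U)].

Definition compactification (X Y : topologicalType) (iota : X -> Y) : Prop :=
  [/\ compact [set: Y], hausdorff_space Y, open_embedding iota &
      dense (range iota)].

Definition boundary (X Y : Type) (iota : X -> Y) : set Y := ~` range iota.

Definition coarse_compactification (R : realType) (X : metricType R)
    (Y : topologicalType) (iota : X -> Y) : Prop :=
  compactification iota /\
  forall (I : Type) (le : I -> I -> Prop) (x y : I -> X),
    directed le ->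
    coarse_entourage (range (fun i => (x i, y i))) ->
    boundary iota `&` cluster (net_tails le (iota \o x)) =
    boundary iota `&` cluster (net_tails le (iota \o y)).

End Compactifications.

Section Freudenthal.
Context {R : realType} {X : metricType R}.
Implicit Type S : set X.

(* Ultrafilters live on the subtype [set_type S]; their members are pushed to
   subsets of X along the inclusion [set_val]. *)
Definition nonprincipal_ultrafilters S : set (set_system (set_type S)) :=
  [set F | UltraFilter F /\ forall s, F <> principal_filter s].

Definition hat S : Type := set_type (@nonprincipal_ultrafilters S).

Definition big_in S (sigma : hat S) (B : set X) : Prop :=
  exists2 C : set (set_type S), set_val sigma C & B = set_val @` C.

Definition lambda_r S (sigma tau : hat S) : Prop :=
  forall A B, big_in sigma A -> big_in tau B -> common_end A B.

Definition lambda_class S (sigma : hat S) : set (hat S) :=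
  [set tau | lambda_r sigma tau].

(* The quotient of [hat S] by [lambda_r], as the type of equivalence classes. *)
Definition Omega S : Type := set_type (range (@lambda_class S)).

Definition cl S (A : set X) : set (Omega S) :=
  [set w | exists2 sigma : hat S,
     set_val w = lambda_class sigma &
     forall B, big_in sigma B -> common_end A B].

Definition freudenthal S : Type := (X + Omega S)%type.

Definition freudenthal_incl S : X -> freudenthal S := inl.

Definition freudenthal_closed S (A : set X) : set (freudenthal S) :=
  (inl @` closure A) `|` (inr @` @cl S A).

HB.instance Definition _ S := Choice.copy (freudenthal S) (X + Omega S)%type.

(* Closed sets generated by the [freudenthal_closed S A]: their complements
   form a subbase of open sets. *)
HB.instance Definition _ S := @isSubBaseTopological.Build (freudenthal S)
  (set X) setT (fun A => ~` @freudenthal_closed S A).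

End Freudenthal.

(* Main.v *)
Require Import Defs.
From HB Require Import structures.
From mathcomp Require Import all_boot all_order all_algebra.
From mathcomp Require Import all_classical all_reals all_analysis.

(** Call two subsets [A], [B] of [X] separated at infinity when they have
    enlargements that cover [X] and are not close. The whole argument is a
    dictionary between such separations and clopen subsets of a boundary.

    On the side of the Freudenthal compactification, an ultrafilter contains one
    of any two sets that cover [X]. Hence a separation [A], [B] splits the boundary
    into the complementary closed sets [cl A] and [cl B]
    ([cl_end_of], [cl_end_ofN]). Since two inequivalent ultrafilters contain
    separated sets by definition, clopen sets separate the points of the boundary,
    which is therefore totally disconnected. Properness
    of [X] and the uniform separation of the points of [S] ensure that no bounded
    set belongs to a nonprincipal ultrafilter on [S] ([ultra_on_unbounded]), so
    that its members stay close to each other at infinity.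

    Conversely, let [Y] be a coarse compactification with totally disconnected
    boundary. In a compact Hausdorff space, a totally disconnected closed set has
    arbitrarily small relatively clopen neighbourhoods of its points, because
    quasi-components are connected; such a neighbourhood is cut out by an open
    [V] of [Y] whose frontier misses the boundary
    ([totally_disconnected_clopen_nbhs]). Coarseness says that a pair of sequences
    at bounded distance cannot straddle such a [V] near infinity, so the trace of
    [V] on [X] and the complement of that trace form a separation
    ([clean_nbhs_not_close]).

    An end is sent to the limit in [Y] of an ultrafilter representing it. The
    separations just described show that equivalent ultrafilters have the same
    limit ([lambda_r_lim]) and that the resulting map is continuous at each
    boundary point ([extend_by_continuous]). It is onto because, [S] being at
    bounded distance from all of [X], coarseness makes every boundary point
    adherent to [S] ([boundary_closure_delone]), hence a limit of an ultrafilter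
    on [S]. *)

Import Order.TTheory GRing.Theory Num.Theory.

Local Open Scope classical_set_scope.
Local Open Scope ring_scope.

(** * Filters and clopen subsets of compact Hausdorff spaces *)

(** An ultrafilter is determined by deciding each set against its complement, a
    property that pushing forward preserves. *)
Lemma ultra_fmap {T U : Type} (f : T -> U) (F : set_system T) :
  UltraFilter F -> UltraFilter (f @ F).
Proof.
move=> FU; split=> [|G PG FG]; first exact: fmap_proper_filter.
rewrite eqEsubset; split => // A GA.
have [//|FnA] := in_ultra_setVsetC (f @^-1` A) FU.
have GnA : G (~` A) by apply: FG.
have /filter_ex[x []] : G (A `&` ~` A) by exact: filterI.
by [].
Qed.

Lemma net_tails_proper {I T : Type} (le : I -> I -> Prop) (x : I -> T) :
  directed le -> ProperFilter (net_tails le x).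
Proof.
move=> [[i0] lexx letr ledir]; apply: filter_from_proper; last first.
  by move=> i _; exists (x i), i => //=.
apply: filter_from_filter; first by exists i0.
move=> i j _ _; have [k ik jk] := ledir i j.
by exists k => // _ [l kl <-]; split; exists l => //=; exact: letr kl.
Qed.

(** Otherwise the sets [A `\` O] generate a proper filter, and a cluster point of
    it would lie in every [A] but not in [O]. *)
Lemma bigcap_compact_sub {T : topologicalType} (F : set (set T)) (O : set T) :
  compact [set: T] -> F !=set0 -> (forall A, F A -> closed A) ->
  (forall A B, F A -> F B -> F (A `&` B)) -> open O ->
  \bigcap_(A in F) A `<=` O -> exists2 A, F A & A `<=` O.
Proof.
move=> cT [A0 FA0] clF FI oO FO; apply: contrapT => nF.
pose G := filter_from F (fun A => A `\` O).
have PG : ProperFilter G.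
  apply: filter_from_proper.
    apply: filter_from_filter; first by exists A0.
    move=> A B FA FB; exists (A `&` B); first exact: FI.
    by move=> x [[Ax Bx] nOx].
  move=> A FA; apply: contrapT => nA; apply: nF; exists A => // x Ax.
  by apply: contrapT => nOx; apply: nA; exists x.
have [x [_ Gx]] := cT G PG filterT.
have nOx : ~ O x.
  move=> Ox; have [||y [[_ nOy] Oy]] := Gx (A0 `\` O) O.
  - by exists A0.
  - exact: open_nbhs_nbhs.
  - exact: nOy Oy.
apply/nOx/FO => A FA; apply: (clF _ FA) => B Bx.
have [|y [[Ay _] By]] := Gx (A `\` O) B _ Bx; first by exists A.
by exists y.
Qed.

Section clopen_neighbourhoods.
Context {T : topologicalType} (K : set T).
Hypotheses (cT : compact [set: T]) (hT : hausdorff_space T).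

Lemma disjoint_closed_nbhs (A B : set T) : closed A -> closed B ->
  A `&` B = set0 ->
  exists U, [/\ open U, A `<=` U & closure U `&` B = set0].
Proof.
move=> clA clB AB; have nT := compact_normal hT cT.
have [|V AV VB] := nT A clA (~` B).
  apply/set_nbhsP; exists (~` B); split => //; first exact: closed_openC.
  exact/disjoints_subset.
have /set_nbhsP[U [oU AU UV]] := AV.
exists U; split => //; apply/disjoints_subset.
exact: subset_trans (closureS UV) VB.
Qed.

(** For closed [K], being open in [K] amounts to the complement in [K] being
    closed in [T], so that no subspace topology is involved. *)
Definition clopen_at (p : T) : set (set T) :=
  [set C | [/\ C p, C `<=` K, closed C & closed (K `\` C)]].

Definition quasi_component (p : T) : set T := \bigcap_(C in clopen_at p) C.

Lemma clopen_atT (p : T) : closed K -> K p -> clopen_at p K.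
Proof. by move=> clK Kp; split=> //; rewrite setDv; exact: closed0. Qed.

Lemma clopen_atI (p : T) (A B : set T) :
  clopen_at p A -> clopen_at p B -> clopen_at p (A `&` B).
Proof.
move=> [Ap AK clA clA'] [Bp BK clB clB']; split=> //.
- by move=> x [/AK].
- exact: closedI.
- by rewrite setDIr; exact: closedU.
Qed.

(** If disjoint closed pieces [E b], containing [p], and [E (~~ b)] made up the
    quasi-component, take [U] around [E b] with closure missing the other piece.
    By compactness one clopen set [C] at [p] already avoids the frontier of [U].
    Then [C `&` U] is clopen at [p] too, so the quasi-component lies in [U] and
    [E (~~ b)] is empty. *)
Lemma quasi_component_connected (p : T) :
  closed K -> K p -> connected (quasi_component p).
Proof.
move=> clK Kp; apply/connectedP => E [E0 QE [sE1 sE2]].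
have clQ : closed (quasi_component p) by apply: closed_bigI => C [].
have Qp : quasi_component p p by move=> C [].
have clE b : closed (E b).
  move=> x Ex; have : quasi_component p x.
    apply: clQ; apply: closureS Ex; rewrite QE.
    by case: b; [exact: subsetUr|exact: subsetUl].
  rewrite QE; case: b Ex => Ex [] // Ebx.
    by have : set0 x by rewrite -sE2.
  by have : set0 x by rewrite -sE1.
have [b Ebp] : exists b, E b p.
  by move: Qp; rewrite QE => -[]; [exists false|exists true].
have EI : E b `&` E (~~ b) = set0.
  have E01 := separated_disjoint (conj sE1 sE2).
  by case: (b) => //; rewrite setIC.
have [U [oU EU UE]] := disjoint_closed_nbhs _ _ (clE b) (clE (~~ b)) EI.
(* A set inside [U `|` ~` closure U] meets [U] and [closure U] alike. *)
have [||||||C CC CO] := @bigcap_compact_sub _ (clopen_at p) (U `|` ~` closure U).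
- exact: cT.
- by exists K; exact: clopen_atT.
- by move=> C [].
- exact: clopen_atI.
- by apply: openU => //; exact/closed_openC/closed_closure.
- move=> x Qx; have : (E b `|` E (~~ b)) x.
    have : quasi_component p x by [].
    by rewrite QE; case: (b) => -[]; by [left|right].
  case=> [/EU|Ex]; first by left.
  right => Ux; have : (set0 : set T) x by rewrite -UE.
  by [].
have [Cp CK clC clKC] := CC.
have CUE : C `&` U = C `&` closure U.
  apply/seteqP; split=> [x [Cx Ux]|x [Cx Ux]]; split => //.
    exact: subset_closure.
  by case: (CO _ Cx).
have CU : clopen_at p (C `&` U).
  split.
  - by split => //; exact: EU.
  - by move=> x [/CK].
  - by rewrite CUE; apply: closedI => //; exact: closed_closure.
  - rewrite setDIr; apply: closedU => //.
    by rewrite setDE; apply: closedI => //; exact: open_closedC.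
have [y Ey] := E0 (~~ b).
have Qy : quasi_component p y.
  by rewrite QE; case: (~~ b) Ey; [right|left].
have [_ Uy] := Qy _ CU.
have : (set0 : set T) y by rewrite -UE; split=> //; exact: subset_closure.
by [].
Qed.

(** The quasi-component of [p] is connected, hence reduced to [p], so that some
    [C] clopen in [K] satisfies [p \in C] and [C `<=` N]. The set [V] is an open
    thickening of [C] in the whole space that stays away from [K `\` C]; the last
    clause says that [V] has no frontier point on [K]. *)
Lemma totally_disconnected_clopen_nbhs (p : T) (N : set T) :
  closed K -> totally_disconnected K -> K p -> nbhs p N ->
  exists V, [/\ open V, V p, V `<=` N & K `&` closure V `<=` V].
Proof.
move=> clK tdK Kp Np.
have Qsub : quasi_component p `<=` N°.
  move=> x Qx; have : connected_component K p x.
    exists (quasi_component p) => //; split.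
    - by move=> C [].
    - by move=> y; apply; exact: clopen_atT.
    - exact: quasi_component_connected.
  by rewrite (tdK _ Kp) => ->.
have [|||||C [Cp CK clC clKC] CN] :=
    @bigcap_compact_sub _ (clopen_at p) (N°) cT.
- by exists K; exact: clopen_atT.
- by move=> C [].
- exact: clopen_atI.
- exact: open_interior.
- exact: Qsub.
have [U [oU CU UC]] : exists U, [/\ open U, C `<=` U &
    closure U `&` (K `\` C) = set0].
  by apply: disjoint_closed_nbhs => //; apply/disjoints_subset => x Cx [].
exists (U `&` N°); split.
- by apply: openI => //; exact: open_interior.
- by split; [exact: CU|exact: CN].
- by move=> x [_ /interior_subset].
- move=> x [Kx /closureI[Ux _]]; have Cx : C x.
    apply: contrapT => nCx; have : (set0 : set T) x by rewrite -UC.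
    by [].
  by split; [exact: CU|exact: CN].
Qed.

End clopen_neighbourhoods.

(** * Bounded, close and separated subsets *)

Section coarse_geometry.
Context {R : realType} {X : metricType R}.
Implicit Types (A B C D : set X) (a b : nat -> X).

Lemma metric_bounded_ball (x : X) (r : R) : metric_bounded (ball x r).
Proof.
exists (r + r) => y z; rewrite ballEmdist /= => /ltW xy /ltW xz.
by rewrite (le_trans (metric_triangle y x z))// lerD// metric_sym.
Qed.

Lemma unbounded_escape A (x0 : X) : ~ metric_bounded A ->
  exists2 a, (forall n, A (a n)) & forall n, n%:R < mdist x0 (a n).
Proof.
move=> nbA; suff /choice[a aP] : forall n : nat, exists x, A x /\ n%:R < mdist x0 x.
  by exists a => n; have [] := aP n.
move=> n; apply: contrapT => nx; apply: nbA; exists (n%:R + n%:R) => x y Ax Ay.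
rewrite (le_trans (metric_triangle x x0 y))// lerD//.
- by rewrite metric_sym leNgt; apply/negP => lt; apply: nx; exists x.
- by rewrite leNgt; apply/negP => lt; apply: nx; exists y.
Qed.

Lemma escaping_unbounded a (x0 : X) : (forall n, n%:R < mdist x0 (a n)) ->
  ~ metric_bounded (range a).
Proof.
move=> aP [M aM]; have d0 : 0 <= mdist x0 (a 0%N) + M.
  by rewrite addr_ge0 ?mdist_ge0// (le_trans _ (aM (a 0%N) (a 0%N) _ _)) ?mdist_ge0.
have := aP (Num.truncn (mdist x0 (a 0%N) + M)).+1; apply/negP; rewrite -leNgt.
rewrite (le_trans (metric_triangle x0 (a 0%N) _))//.
rewrite (@le_trans _ _ (mdist x0 (a 0%N) + M)) ?lerD2l ?aM//.
by rewrite ltW// truncnS_gt.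
Qed.

(** An unbounded sequence in [D], paired with itself, is a witness. *)
Lemma unbounded_are_close A B D :
  ~ metric_bounded D -> D `<=` A -> D `<=` B -> are_close A B.
Proof.
move=> nbD DA DB; have [x0 _] : D !=set0.
  apply: contrapT => D0; apply: nbD; exists 0 => x y Dx.
  by exfalso; apply: D0; exists x.
have [a aD ax0] := unbounded_escape _ x0 nbD.
exists a, a; split; [by move=> i; exact: DA|by move=> i; exact: DB| |].
  by case; have := escaping_unbounded _ _ ax0.
by exists 0 => // i; rewrite mdistxx.
Qed.

Lemma are_closeC A B : are_close A B -> are_close B A.
Proof.
move=> [a [b [aA bB nb [r r0 abr]]]]; exists b, a; split => //.
  by move=> [? ?]; exact: nb.
by exists r => // i; rewrite metric_sym.
Qed.

Lemma end_separated_sub A B C D :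
  C `<=` A -> D `<=` B -> end_separated A B -> end_separated C D.
Proof.
move=> CA DB [A' [B' [AA' BB' AB' nc]]]; exists A', B'; split=> //.
  exact: subset_trans AA'.
exact: subset_trans BB'.
Qed.

Lemma end_separatedC A B : end_separated A B -> end_separated B A.
Proof.
move=> [A' [B' [AA' BB' AB' nc]]]; exists B', A'; split=> //.
  by rewrite setUC.
by move/are_closeC.
Qed.

Lemma end_separated_setC A : ~ are_close A (~` A) -> end_separated A (~` A).
Proof. by move=> nc; exists A, (~` A); split=> //; rewrite setUCr. Qed.

(** Passing to a subsequence turns closeness into a pair of sequences that leave
    every ball around [x0], the form in which a coarse compactification can be
    applied to them. The components of the original pair are at bounded distance,
    so if one were bounded then both would be. *)
Lemma are_close_escape A B (x0 : X) : are_close A B ->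
  exists a b, [/\ forall n, A (a n), forall n, B (b n),
    forall n, n%:R < mdist x0 (a n) &
    coarse_entourage (range (fun n => (a n, b n)))].
Proof.
move=> [a [b [aA bB nb [r r0 abr]]]].
have nba : ~ metric_bounded (range a).
  move=> ba; apply: nb; split=> //; have [M aM] := ba.
  exists (r + (M + r)) => _ _ [i _ <-] [j _ <-].
  rewrite (le_trans (metric_triangle _ (a i) _))// lerD//.
    by rewrite metric_sym.
  rewrite (le_trans (metric_triangle _ (a j) _))// lerD// aM//.
have [u ua ux0] := unbounded_escape _ x0 nba.
have /choice[k ka] : forall n, exists i, a i = u n.
  by move=> n; have [i _] := ua n; exists i.
exists (a \o k), (b \o k); split => /=; try by move=> n.
  by move=> n; rewrite ka.
by exists r => _ _ [n _ [<- <-]].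
Qed.

End coarse_geometry.

(** * Ends as classes of ultrafilters *)

Section ends.
Context {R : realType} {X : metricType R} {S : set X}.
Implicit Types (A B : set X) (s t u : @hat R X S) (w : @Omega R X S).

(** The ultrafilter on the subtype [S], seen as an ultrafilter on [X]; the sets
    of [big_in] are cofinal in it, and it is the more convenient object because it
    is closed under enlargement. *)
Definition ultra_on s : set_system X := set_val @ (set_val s : set_system S).

Lemma ultra_on_ultra s : UltraFilter (ultra_on s).
Proof. by have [us _] := set_valP s; exact: ultra_fmap. Qed.

Lemma big_in_ultra_on s A : big_in s A -> ultra_on s A.
Proof.
have us := ultra_on_ultra s; have [us' _] := set_valP s.
move=> [C sC ->]; apply: filterS sC; exact: preimage_image.
Qed.

Lemma ultra_on_big_in s A : ultra_on s A -> exists2 B, big_in s B & B `<=` A.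
Proof.
move=> sA; exists (set_val @` (set_val @^-1` A : set S)).
  by exists (set_val @^-1` A).
exact: image_preimage_subset.
Qed.

Lemma lambda_rP s t : lambda_r s t <->
  forall A B, ultra_on s A -> ultra_on t B -> common_end A B.
Proof.
split=> [st A B /ultra_on_big_in[A' sA' A'A] /ultra_on_big_in[B' tB' B'B] sep|].
  by apply: (st _ _ sA' tB'); exact: end_separated_sub sep.
by move=> st A B /big_in_ultra_on sA /big_in_ultra_on tB; exact: st.
Qed.

Lemma common_end_big_inP s A : (forall B, big_in s B -> common_end A B) <->
  forall B, ultra_on s B -> common_end A B.
Proof.
split=> AP B; last by move=> /big_in_ultra_on; exact: AP.
move=> /ultra_on_big_in[C sC CB] sep.
by apply: (AP _ sC); exact: end_separated_sub sep.
Qed.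

Lemma lambda_r_sym s t : lambda_r s t -> lambda_r t s.
Proof. by move=> st A B tA sB /end_separatedC; exact: st. Qed.

(** A separation of [A] and [B] covers [X] by two sets, and an ultrafilter contains
    one of them: every end is separated from [A] or from [B]. Transitivity of
    [lambda_r] and the behaviour of [cl] both rest on this. *)
Lemma separated_ultra_on s A B : end_separated A B ->
  exists2 C, ultra_on s C & end_separated A C \/ end_separated C B.
Proof.
move=> [A' [B' [AA' BB' AB nc]]].
have [sA|sA] := in_ultra_setVsetC A' (ultra_on_ultra s).
  by exists A' => //; right; exists A', B'; split.
exists (~` A') => //; left; exists A', B'; split => // x nAx.
by have : setT x by []; rewrite -AB => -[].
Qed.

Lemma lambda_r_trans s t u : lambda_r s t -> lambda_r t u -> lambda_r s u.
Proof.
move=> /lambda_rP st /lambda_rP tu; apply/lambda_rP => A B sA uB sep.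
have [C tC [AC|CB]] := separated_ultra_on t _ _ sep.
  exact: st AC.
exact: tu CB.
Qed.

Definition end_of s : Omega S :=
  exist _ (lambda_class s) (mem_set (imageT (@lambda_class R X S) s)).

Lemma end_of_surj w : exists s, end_of s = w.
Proof.
have [s _ sw] := set_valP w; exists s; exact: val_inj.
Qed.

Lemma lambda_r_end_of s t : lambda_r s t -> end_of s = end_of t.
Proof.
move=> st; apply: val_inj; apply/seteqP; split => u /= su.
  exact: lambda_r_trans (lambda_r_sym _ _ st) su.
exact: lambda_r_trans st su.
Qed.

Hypotheses (properX : proper_metric X) (deloneS : delone S).

(** This is where properness and the uniform separation of [S] enter. A bounded
    member would make the ultrafilter converge to some [x] by compactness of the
    closure; then it contains a small ball around [x], which meets [S] in a single
    point, and the ultrafilter would be principal. *)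
Lemma ultra_on_unbounded s A : ultra_on s A -> ~ metric_bounded A.
Proof.
move=> sA bA; have [[r r0 Sr] _] := deloneS; have [us ns] := set_valP s.
have uS := ultra_on_ultra s.
have [x [_ sx]] : closure A `&` [set x | ultra_on s --> x] !=set0.
  have := properX _ bA; rewrite compact_ultra; apply => //.
  by apply: filterS sA; exact: subset_closure.
have sball : (set_val s : set_system S) (set_val @^-1` ball x (r / 2)).
  by apply: sx; apply: nbhsx_ballx; rewrite divr_gt0.
have [p0 xp0] := filter_ex sball.
(* The separation of [S] leaves at most one of its points in the ball. *)
have ball1 : set_val @^-1` ball x (r / 2) `<=` [set p0].
  move=> p xp; apply: contrapT => pp0.
  have : r <= mdist (set_val p) (set_val p0).
    by apply: Sr; [exact: set_valP|exact: set_valP|move/val_inj].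
  move: xp xp0; rewrite /= ballEmdist /= => xp xp0.
  apply/negP; rewrite -ltNge (le_lt_trans (metric_triangle _ x _))//.
  by rewrite [ltRHS]splitr ltrD// metric_sym.
apply: (ns p0); apply: (@max_filter _ _ (principal_filter_ultra p0)).
move=> W /principal_filterP Wp0; apply: filterS sball => p /ball1 -> //.
Qed.

(** Two members of one ultrafilter share an unbounded set, so no enlargements of
    them fail to be close. *)
Lemma lambda_r_refl s : lambda_r s s.
Proof.
apply/lambda_rP => A B sA sB [A' [B' [AA' BB' _]]]; apply.
have us := ultra_on_ultra s.
apply: (@unbounded_are_close _ _ _ _ (A `&` B)).
- by apply: (ultra_on_unbounded s); exact: filterI.
- by move=> x [/AA'].
- by move=> x [_ /BB'].
Qed.

Lemma end_of_lambda_r s t : end_of s = end_of t -> lambda_r s t.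
Proof.
move=> st; have E : lambda_class s = lambda_class t := congr1 set_val st.
by rewrite -[lambda_r s t]/(lambda_class s t) E; exact: lambda_r_refl.
Qed.

Lemma cl_end_of s A : ultra_on s A -> cl A (end_of s).
Proof.
move=> sA; exists s => //; apply/common_end_big_inP => B sB.
by have /lambda_rP ss := lambda_r_refl s; exact: ss.
Qed.

(** If an equivalent ultrafilter [t] witnessed [cl A], the separation would force a
    member of [t] to be separated from [A] or from [B \in s], against the choice
    of [t] or the equivalence of [s] and [t]. *)
Lemma cl_end_ofN s A B : end_separated A B -> ultra_on s B -> ~ cl A (end_of s).
Proof.
move=> sep sB [t st /common_end_big_inP At].
have /lambda_rP ts : lambda_r t s.
  by rewrite -[lambda_r t s]/(lambda_class t s) -st; exact: lambda_r_refl.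
have [C tC [AC|CB]] := separated_ultra_on t _ _ sep.
  exact: At AC.
exact: ts CB.
Qed.

Lemma freudenthal_open A : open (~` @freudenthal_closed R X S A).
Proof.
exists [set ~` freudenthal_closed A]; last by rewrite bigcup_set1.
by move=> _ ->; exact: (@finI_from1 _ _ setT (fun B => ~` freudenthal_closed B)).
Qed.

Lemma freudenthal_boundary : boundary (@freudenthal_incl R X S) = range inr.
Proof.
apply/seteqP; split=> [[x|w]|_ [w _ <-]].
- by move=> nx; exfalso; apply: nx; exists x.
- by move=> _; exists w.
- by case.
Qed.

Lemma freudenthal_closed_inr A w : freudenthal_closed A (inr w) <-> cl A w.
Proof. split=> [[[x _]//|[v vA [<-]]]|Aw]; first by [].
by right; exists w. Qed.

(** Inequivalent ultrafilters [s] and [t] contain sets with enlargements [A], [B]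
    that cover [X] and are not close. Every ultrafilter contains [A] or [B], and
    no end is adherent to both, so [cl A] and [cl B] are complementary closed
    subsets of the boundary that separate the two ends. *)
Lemma freudenthal_boundary_totally_disconnected :
  totally_disconnected (boundary (@freudenthal_incl R X S)).
Proof.
rewrite freudenthal_boundary => x [w _ wx]; subst x.
apply/seteqP; split=> [y|y ->]; last by apply: connected_component_refl; exists w.
move=> [C [Cw CE conC] Cy]; have [v _ vy] := CE _ Cy; subst y.
congr inr; have [s sw] := end_of_surj w; have [t tv] := end_of_surj v.
subst w v; apply/esym/lambda_r_end_of/lambda_rP => A0 B0 sA0 tB0.
move=> [A [B [A0A B0B ABT nc]]].
have us := ultra_on_ultra s; have ut := ultra_on_ultra t.
have sep : end_separated A B by exists A, B; split.
have sA : ultra_on s A by exact: filterS sA0.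
have tB : ultra_on t B by exact: filterS tB0.
have clE u : cl A (end_of u) <-> ~ cl B (end_of u).
  have [uA|unA] := in_ultra_setVsetC A (ultra_on_ultra u).
    split=> _; last exact: cl_end_of.
    exact: cl_end_ofN (end_separatedC _ _ sep) uA.
  have uu := ultra_on_ultra u; have uB : ultra_on u B.
    by apply: filterS unA => x nAx; have : setT x by []; rewrite -ABT => -[].
  split=> [|nB]; first by move/(cl_end_ofN _ _ _ sep uB).
  by exfalso; apply: nB; exact: cl_end_of.
have CAB : C `&` freudenthal_closed A = C `&` ~` freudenthal_closed B.
  apply/seteqP; split=> x [Cx]; have [v _ vx] := CE _ Cx; subst x;
    have [u uv] := end_of_surj v; subst v.
  - by move=> /freudenthal_closed_inr/clE nB; split=> // /freudenthal_closed_inr.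
  - move=> nB; split=> //; apply/freudenthal_closed_inr/clE => uB.
    by apply: nB; apply/freudenthal_closed_inr.
have CA : C `&` freudenthal_closed A = C.
  apply: conC.
  - by exists (inr (end_of s)); split=> //; apply/freudenthal_closed_inr/cl_end_of.
  - by exists (~` freudenthal_closed B) => //; exact: freudenthal_open.
  - exists (freudenthal_closed A) => //.
    by rewrite -[freudenthal_closed A]setCK; exact/open_closedC/freudenthal_open.
move: Cy; rewrite -CA => -[_ /freudenthal_closed_inr].
exact: cl_end_ofN sep tB.
Qed.

End ends.

(** * The limit map to a coarse compactification *)

Lemma open_embedding_nbhs {X Y : topologicalType} (iota : X -> Y) (x : X)
  (A : set X) : open_embedding iota -> nbhs x A -> nbhs (iota x) (iota @` A).
Proof.
move=> [_ _ oi]; rewrite nbhsE => -[U [oU Ux] UA].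
apply: (@filterS _ (nbhs (iota x)) _ (iota @` U)); first exact: image_subset.
apply: open_nbhs_nbhs.
by split; [exact: oi|exists x].
Qed.

Definition extend_by {R : realType} {X : metricType R} {Y : Type} {S : set X}
  (iota : X -> Y) (g : @Omega R X S -> Y) (z : @freudenthal R X S) : Y :=
  match z with inl x => iota x | inr w => g w end.

Section coarse_compactifications.
Context {R : realType} {X : metricType R} {Y : topologicalType} {iota : X -> Y}.
Hypothesis coarseY : coarse_compactification iota.

Let compactY : compact [set: Y]. Proof. by case: coarseY => -[]. Qed.
Let hausdorffY : hausdorff_space Y. Proof. by case: coarseY => -[]. Qed.
Let embedding : open_embedding iota. Proof. by case: coarseY => -[]. Qed.

Lemma boundary_closed : closed (boundary iota).
Proof. by apply: open_closedC; case: embedding => _ _; apply; exact: openT. Qed.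

(** Around a point of [X] the compactification looks like [X], so a filter that
    converges there contains a ball. *)
Lemma boundary_lim (F : set_system X) (p : Y) :
  (forall x, ~ F (ball x 1)) -> iota @ F --> p -> boundary iota p.
Proof.
move=> nF Fp [x _ xp]; subst p; apply: (nF x).
have := Fp _ (open_embedding_nbhs _ _ _ embedding (nbhsx_ballx x _ ltr01)).
rewrite /fmap /= nbhs_simpl /=; congr (F _); apply/seteqP; split=> y /=.
  by case: embedding => inj _ _ [z xz /inj <-].
by move=> xy; exists y.
Qed.

(** The bridge between clopen subsets of the boundary and separations of [X].
    Close sequences [a] in [V] and [b] outside [V] could be chosen escaping to
    infinity; a cluster point of [a] is then a boundary point of [closure V], hence
    lies in the open set [V], yet by coarseness it is also a cluster point of [b],
    which avoids [V]. *)
Lemma clean_nbhs_not_close (V : set Y) : open V ->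
  boundary iota `&` closure V `<=` V ->
  ~ are_close (iota @^-1` V) (~` (iota @^-1` V)).
Proof.
move=> oV clV close.
have [x0 _] : exists x : X, True.
  by case: close => a _; exists (a 0%N).
have [a [b [aV bV ax0 abE]]] := are_close_escape _ _ x0 close.
pose le (i j : nat) : Prop := (i <= j)%N.
have dir : directed le.
  split; first exact: (inhabits 0%N).
  - by move=> i; exact: leqnn.
  - by move=> i j k; exact: leq_trans.
  - by move=> i j; exists (maxn i j); rewrite /le ?leq_maxl ?leq_maxr.
have PF : ProperFilter (net_tails le (iota \o a)) := net_tails_proper _ _ dir.
have [q [_ aq]] := compactY _ PF filterT.
have nq : boundary iota q.
  move=> [x _ xq]; subst q.
  (* Beyond this index the sequence is farther from [x0] than the ball. *)
  pose n := (Num.truncn (mdist x0 x + 1)).+1.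
  have [||_ [[j nj <-]]] := aq ((iota \o a) @` [set j | le n j]) (iota @` ball x 1).
  - by exists n.
  - exact: open_embedding_nbhs embedding (nbhsx_ballx x _ ltr01).
  - case: embedding => inj _ _ [z + /inj zj]; rewrite {}zj ballEmdist /= => xj.
    have := ax0 j; apply/negP; rewrite -leNgt ltW//.
    rewrite (le_lt_trans (metric_triangle _ x _))//.
    rewrite (lt_trans (y := mdist x0 x + 1)) ?ltrD2l//.
    by rewrite (lt_le_trans (truncnS_gt _))// ler_nat.
have Vq : V q.
  apply: clV; split=> // B Bq.
  have [|_ [[j _ <-] Bj]] := aq ((iota \o a) @` [set j | le 0%N j]) B _ Bq.
    by exists 0%N.
  by exists (iota (a j)); split => //; exact: aV.
have [_ coarse] := coarseY.
have : (boundary iota `&` cluster (net_tails le (iota \o a))) q by [].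
rewrite (coarse _ _ _ _ dir abE) => -[_ bq].
have [||_ [[j _ <-] Vj]] := bq ((iota \o b) @` [set j | le 0%N j]) V.
- by exists 0%N.
- exact: open_nbhs_nbhs.
- exact: bV Vj.
Qed.

(** A net in [X] converging to a boundary point may be moved into [S] by a bounded
    amount, which keeps the point as a cluster point. *)
Lemma boundary_closure_delone (S : set X) : delone S ->
  boundary iota `<=` closure (iota @` S).
Proof.
move=> [_ [E [M EM] ES]] p np.
have /choice[s sP] : forall x, exists s, S s /\ E (x, s).
  by move=> x; have : setT x by []; rewrite -ES => -[y Sy xy]; exists y.
(* The net of all points of [X] close to [p], each indexed by itself together with
   a neighbourhood of [p] that contains it. *)
pose I := {i : set Y * X | nbhs p i.1 /\ i.1 (iota i.2)}.
pose le (i j : I) := (sval j).1 `<=` (sval i).1.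
have [[_ _ _ dense_iota] coarse] := coarseY.
have ex (U : set Y) : nbhs p U -> exists i : I, (sval i).1 = U.
  move=> pU; have [|y [Uy [x _ xy]]] := dense_iota U° _ (open_interior U).
    by exists p.
  have Ux : U (iota x) by apply: interior_subset; rewrite xy.
  by exists (exist _ (U, x) (conj pU Ux)).
have dir : directed le.
  split.
  - by have [i _] := ex setT filterT; constructor.
  - by move=> i x.
  - by move=> i j k ij jk x /jk/ij.
  - move=> [[U x] [/= Up Ux]] [[V y] [/= Vp Vy]].
    have [k kUV] := ex (U `&` V) (filterI Up Vp).
    by exists k; rewrite /le kUV => z [].
pose x (i : I) := (sval i).2.
have xsE : coarse_entourage (range (fun i => (x i, s (x i)))).
  by exists M => _ _ [i _ [<- <-]]; apply: EM; have [] := sP (x i).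
have : (boundary iota `&` cluster (net_tails le (iota \o x))) p.
  split => // A B [i _ iA] Bp; have [ip _] := svalP i.
  have [j jE] := ex ((sval i).1 `&` B) (filterI ip Bp).
  have [_] := svalP j; rewrite jE => -[_ Bj].
  exists (iota (x j)); split => //; apply: iA; exists j => //.
  by rewrite /= /le jE => z [].
rewrite (coarse _ _ _ _ dir xsE) => -[_ sp] B Bp.
have [i0 _] := ex setT filterT.
have [|_ [[j _ <-] Bj]] := sp ((iota \o (s \o x)) @` [set j | le i0 j]) B _ Bp.
  by exists i0.
exists (iota (s (x j))); split => //; exists (s (x j)) => //.
by have [] := sP (x j).
Qed.

Section limits_of_ends.
Context {S : set X}.
Hypotheses (properX : proper_metric X) (deloneS : delone S).
Hypothesis boundaryY : totally_disconnected (boundary iota).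
Implicit Types s t : @hat R X S.

Lemma ultra_on_boundary_lim s (p : Y) :
  iota @ ultra_on s --> p -> boundary iota p.
Proof.
apply: boundary_lim => x sx.
exact: ultra_on_unbounded sx (metric_bounded_ball x 1).
Qed.

(** The limit is a boundary point, and [V] has no frontier there, so it lies in [V]
    or in the exterior of [V]. *)
Lemma lim_cleanP s (p : Y) (V : set Y) : open V ->
  boundary iota `&` closure V `<=` V -> iota @ ultra_on s --> p ->
  V p <-> ultra_on s (iota @^-1` V).
Proof.
move=> oV clV sp; split=> [Vp|sV]; first by apply: sp; exact: open_nbhs_nbhs.
apply: clV; split; first exact: ultra_on_boundary_lim sp.
move=> B Bp; have us := ultra_on_ultra s.
have sB : ultra_on s (iota @^-1` B) by exact: sp.
by have [x [Vx Bx]] := filter_ex (filterI sV sB); exists (iota x).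
Qed.

(** Distinct limits would be separated by a [V] without frontier on the boundary,
    and the traces on [X] of [V] and of its complement would separate [s] from
    [t]. *)
Lemma lambda_r_lim s t (p q : Y) : lambda_r s t ->
  iota @ ultra_on s --> p -> iota @ ultra_on t --> q -> p = q.
Proof.
move=> /lambda_rP st sp tq; apply: contrapT => pq.
have np := ultra_on_boundary_lim _ _ sp.
have Np : nbhs p (~` [set q]).
  apply: open_nbhs_nbhs; split=> //; apply: closed_openC.
  exact/accessible_closed_set1/hausdorff_accessible.
have [V [oV Vp Vq clV]] := totally_disconnected_clopen_nbhs _ compactY hausdorffY
  _ _ boundary_closed boundaryY np Np.
apply: (st (iota @^-1` V) (~` (iota @^-1` V))).
- exact/(lim_cleanP _ _ _ oV clV sp).
- have [/(lim_cleanP _ _ _ oV clV tq) qV|//] :=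
    in_ultra_setVsetC (iota @^-1` V) (ultra_on_ultra t).
  by exfalso; exact: Vq qV _.
- exact/end_separated_setC/clean_nbhs_not_close.
Qed.

Lemma end_lim_ex : exists g : @Omega R X S -> Y,
  forall s, iota @ ultra_on s --> g (end_of s).
Proof.
have lim_ex s : exists p : Y, iota @ ultra_on s --> p.
  have us := ultra_fmap iota _ (ultra_on_ultra s).
  have := compactY; rewrite compact_ultra => /(_ _ us filterT)[p [_ sp]].
  by exists p.
have /choice[g gP] : forall w, exists p : Y,
    forall s, end_of s = w -> iota @ ultra_on s --> p.
  move=> w; have [t tw] := end_of_surj w; have [p tp] := lim_ex t.
  exists p => s sw; have [q sq] := lim_ex s.
  suff <- : q = p by [].
  apply: lambda_r_lim sq tp.
  apply: end_of_lambda_r => //; exact: etrans sw (esym tw).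
by exists g => s; exact: gP.
Qed.

(** The neighbourhoods of [p] trace a proper filter on [S], and any ultrafilter
    refining it converges to [p]; it is not principal because [p] is not in the
    image of [X]. *)
Lemma end_of_lim (p : Y) : boundary iota p ->
  exists s : @hat R X S, iota @ ultra_on s --> p.
Proof.
move=> np; have clp := boundary_closure_delone _ deloneS _ np.
pose G := filter_from (nbhs p) (fun U => (iota \o set_val) @^-1` U : set S).
have PG : ProperFilter G.
  apply: filter_from_proper.
    apply: filter_from_filter; first by exists setT; exact: filterT.
    by move=> U V pU pV; exists (U `&` V) => //; exact: filterI.
  move=> U pU; have [_ [[x Sx <-] Ux]] := clp _ pU.
  by exists (exist _ x (mem_set Sx)).
have [F [uF GF]] := ultraFilterLemma PG.
have Fp : iota @ (set_val @ F) --> p.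
  by move=> U pU; apply: GF; exists U.
have nF : @nonprincipal_ultrafilters R X S F.
  split=> // x Fx; apply: np; exists (set_val x) => //.
  apply/esym; apply: hausdorffY => U V pU; rewrite nbhsE => -[W [oW Wx] WV].
  have := Fp _ pU; rewrite Fx /fmap /= nbhs_simpl /= => /principal_filterP Ux.
  by exists (iota (set_val x)); split => //; exact: WV.
by exists (exist _ F (mem_set nF)).
Qed.

(** Choose [V] around the image of [w], inside the given neighbourhood and without
    frontier on the boundary. The complement [A] of its trace on [X] is separated
    from the end [w], so the closed set generated by [A] misses [w]; every point
    off that closed set is sent into [V]. *)
Lemma extend_by_continuous (g : @Omega R X S -> Y) (w : @Omega R X S) :
  (forall s, iota @ ultra_on s --> g (end_of s)) ->
  {for inr w : freudenthal S, continuous (extend_by iota g)}.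
Proof.
move=> gP N /= Nw; have [s sw] := end_of_surj w; subst w.
have [V [oV Vs VN clV]] := totally_disconnected_clopen_nbhs _ compactY hausdorffY
  _ _ boundary_closed boundaryY (ultra_on_boundary_lim _ _ (gP s)) Nw.
have sep := end_separated_setC _ (clean_nbhs_not_close _ oV clV).
pose A := ~` (iota @^-1` V).
have nAs : nbhs (inr (end_of s) : freudenthal S) (~` freudenthal_closed A).
  apply: open_nbhs_nbhs; split; first exact: freudenthal_open.
  move/freudenthal_closed_inr.
  apply: (cl_end_ofN properX deloneS) (end_separatedC _ _ sep) _.
  exact/(lim_cleanP _ _ _ oV clV (gP s)).
apply: filterS nAs => -[x|v] nAx; apply: VN => /=.
  apply: contrapT => nVx; apply: nAx; left; exists x => //.
  exact: subset_closure.
have [t tv] := end_of_surj v; subst v; apply: contrapT => nVt.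
apply: nAx; apply/freudenthal_closed_inr/cl_end_of => //.
by have [/(lim_cleanP _ _ _ oV clV (gP t))|] :=
  in_ultra_setVsetC (iota @^-1` V) (ultra_on_ultra t).
Qed.

End limits_of_ends.

End coarse_compactifications.

Theorem theoremC (R : realType) (X : metricType R) (S : set X) :
  proper_metric X -> delone S ->
  totally_disconnected (boundary (freudenthal_incl S)) /\
  forall (Xbar : topologicalType) (iota : X -> Xbar),
    coarse_compactification iota ->
    totally_disconnected (boundary iota) ->
    exists f : freudenthal S -> Xbar,
      [/\ forall p : Xbar, exists w : freudenthal S, f w = p,
          forall w : freudenthal S, boundary (freudenthal_incl S) w ->
            {for w, continuous f} &
          forall x : X, f (freudenthal_incl S x) = iota x].
Proof.
move=> properX deloneS; split.
  exact: freudenthal_boundary_totally_disconnected.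
move=> Y iota coarseY tdY.
have [g gP] := end_lim_ex coarseY properX deloneS tdY.
exists (extend_by iota g); split => [p|w|//].
- have [[x _ xp]|np] := pselect (range iota p); first by exists (inl x).
  have [s sp] := end_of_lim coarseY deloneS _ np.
  exists (inr (end_of s)) => /=.
  apply: (lambda_r_lim coarseY properX deloneS tdY _ _ _ _ _ (gP s) sp).
  exact: lambda_r_refl.
- rewrite freudenthal_boundary => -[v _ <-].
  exact: extend_by_continuous.
Qed.
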